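(* For every complex number $q$ with $|q|<1$, $$\sum_{n=0}^\infty \frac{q^{n(n+2)}(-q;q^2)_n}{(q^4;q^4)_n} = \frac{f(-q,-q^5)}{\psi(-q)} = \frac{(q^6;q^6)_\infty}{(q^4;q^4)_\infty(q^3,q^9;q^{12})_\infty}.$$
   Context: Notation: $(a;q)_n=\prod_{j=0}^{n-1}(1-aq^j)$ (so $(a;q)_0=1$), $(a;q)_\infty=\prod_{j=0}^\infty(1-aq^j)$, and $(a_1,\dots,a_r;q)_\infty=(a_1;q)_\infty\cdots(a_r;q)_\infty$; the base may be replaced by a power of $q$. Ramanujan's theta function is $f(a,b)=\sum_{n=-\infty}^\infty a^{n(n+1)/2}b^{n(n-1)/2}$ for $|ab|<1$ (with $0^0=1$), and $\psi(q)=f(q,q^3)$; $\psi(-q)$ is $\psi$ evaluated at $-q$. *)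

(* Defs.v *)
From Stdlib Require Import Reals ZArith.
From Coquelicot Require Import Coquelicot.

Local Open Scope C_scope.

(* [iota] picks the limit when there is one (it is unique in [C]), as in
   Coquelicot's [RInt]; the values are meaningful only in case of convergence. *)
Definition CLim_seq (u : nat -> C) : C :=
  iota (T := C_CompleteNormedModule) (fun l : C => filterlim u eventually (locally l)).

Definition CSeries (a : nat -> C) : C :=
  iota (T := C_CompleteNormedModule) (fun l : C => is_series a l).

(* (a;q)_n *)
Fixpoint qpoch (a q : C) (n : nat) : C :=
  match n with
  | O => 1
  | S m => qpoch a q m * (1 - a * q ^ m)
  end.

(* (a;q)_oo *)
Definition qpoch_inf (a q : C) : C := CLim_seq (fun n => qpoch a q n).

(* Both exponents are nonnegative integers for every [n : Z], so [Z.to_nat] and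
   the division by 2 are exact; [Cpow] satisfies 0 ^ 0 = 1. *)
Definition theta_term (a b : C) (n : Z) : C :=
  a ^ Z.to_nat (n * (n + 1) / 2) * b ^ Z.to_nat (n * (n - 1) / 2).

(* Ramanujan's f(a,b): the bilateral sum, which converges absolutely for
   |ab| < 1, is split into its parts n >= 0 and n <= -1. *)
Definition ramanujan_f (a b : C) : C :=
  CSeries (fun n : nat => theta_term a b (Z.of_nat n)) +
  CSeries (fun n : nat => theta_term a b (- Z.of_nat (S n))).

Definition ramanujan_psi (q : C) : C := ramanujan_f q (q ^ 3).

(* Main.v *)
Require Import Defs.
From Stdlib Require Import Reals ZArith Lra Lia.
From Coquelicot Require Import Coquelicot.

(** The identity is an instance of Bailey's lemma, in base p = q^2. The numbers
    1 / (p^2;p^2)_n have an expansion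

      1 / (p^2;p^2)_n
        = sum_(r <= n) (-1)^r p^(r^2) (1 - p^(2r+1)) / ((p;p)_(n-r) (p;p)_(n+r+1))

    ([bailey_pair_sum]). Multiply it by q^(n(n+2)) (-q;q^2)_n / (p;p)_(N-n), sum
    over n <= N and exchange the sums: the inner sum over n is of
    q-Chu-Vandermonde type and has a closed form ([chu_vandermonde_sum]). The
    result is the finite identity [finite_mod6_identity]

      sum_(n <= N) q^(n(n+2)) (-q;q^2)_n / ((q^4;q^4)_n (p;p)_(N-n))
        = (-q;q^2)_(N+1)
          sum_(r <= N) (-1)^r q^(3r^2+2r) (1 - q^(2r+1)) / ((p;p)_(N-r) (p;p)_(N+r+1)).

    Both sides are sums of dominated terms with weights that converge as N grows,
    so Tannery's theorem ([tannery]) applies. The numerators on the right are those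
    of the theta series f(-q^5,-q), its terms of index r and -r-1 taken together
    ([theta_term_mod6]). Hence [mod6_sum]: the series of the theorem has the sum
    (-q;q^2)_oo f(-q,-q^5) / (q^2;q^2)_oo.

    What remains are products. Jacobi's triple product ([jacobi_triple_product])
    is the limit of a finite identity of the same shape, obtained from the two
    q-Pascal rules; it evaluates f(-q,-q^5) and psi(-q). Splitting products by
    residues of the exponent ([qpoch_inf_split2], [qpoch_inf_split3]), together
    with (q;q^2)_oo (-q;q^2)_oo = (q^2;q^4)_oo ([qpoch_inf_mul_opp]), gives
    (q^2;q^2)_oo = psi(-q) (-q;q^2)_oo, hence the quotient f / psi, and its product
    form. *)

Local Open Scope C_scope.

(** * Limits of complex sequences *)

Definition tends (u : nat -> C) (l : C) : Prop :=
  filterlim u eventually (locally l).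

Lemma tends_eps (u : nat -> C) (l : C) :
  tends u l <->
  forall eps : R, (0 < eps)%R ->
    exists N : nat, forall n : nat, (N <= n)%nat -> (Cmod (u n - l) < eps)%R.
Proof.
  split.
  - intros H eps Heps.
    destruct (proj1 (filterlim_locally_ball_norm (U := C_NormedModule) u l) H
                (mkposreal eps Heps)) as [N HN].
    exists N; intros n Hn; exact (HN n Hn).
  - intros H.
    apply (proj2 (filterlim_locally_ball_norm (U := C_NormedModule) u l)).
    intros [eps Heps]. destruct (H eps Heps) as [N HN].
    exists N; intros n Hn; exact (HN n Hn).
Qed.

Lemma tends_unique (u : nat -> C) (l m : C) : tends u l -> tends u m -> l = m.
Proof.
  apply (filterlim_locally_unique (V := C_NormedModule)).
Qed.

Lemma tends_ext (u v : nat -> C) (l : C) :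
  (forall n, u n = v n) -> tends u l -> tends v l.
Proof. intros H; apply filterlim_ext; exact H. Qed.

Lemma tends_const (c : C) : tends (fun _ => c) c.
Proof. apply filterlim_const. Qed.

Lemma tends_plus (u v : nat -> C) (l m : C) :
  tends u l -> tends v m -> tends (fun n => u n + v n) (l + m).
Proof.
  exact (fun Hu Hv =>
    filterlim_comp_2 _ _ _ Hu Hv (filterlim_plus (V := C_NormedModule) l m)).
Qed.

Lemma tends_mult (u v : nat -> C) (l m : C) :
  tends u l -> tends v m -> tends (fun n => u n * v n) (l * m).
Proof.
  (* [C] carries two uniform structures, from the product and from the modulus;
     [filterlim_mult] is about the second one. *)
  assert (H : forall (w : nat -> C) (k : C), tends w k <->
    filterlim w eventually (locally (T := AbsRing_UniformSpace C_AbsRing) k)).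
  { intros w k.
    assert (F := filterlim_locally (U := AbsRing_UniformSpace C_AbsRing)
                   (F := eventually) w k).
    split; intros Hw.
    - apply F. intros [eps Heps]. exact (proj1 (tends_eps w k) Hw eps Heps).
    - apply tends_eps. intros eps Heps.
      exact (proj1 F Hw (mkposreal eps Heps)). }
  rewrite !H. intros Hu Hv.
  exact (filterlim_comp_2 _ _ _ Hu Hv (filterlim_mult (K := C_AbsRing) l m)).
Qed.

Lemma tends_subseq (u : nat -> C) (l : C) (phi : nat -> nat) (c : nat) :
  (forall n, (n <= phi n + c)%nat) -> tends u l -> tends (fun n => u (phi n)) l.
Proof.
  intros Hphi Hu. apply tends_eps; intros eps Heps.
  destruct (proj1 (tends_eps u l) Hu eps Heps) as [N HN].
  exists (N + c)%nat; intros n Hn; apply HN. specialize (Hphi n); lia.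
Qed.

Lemma tends_inv (u : nat -> C) (l : C) :
  l <> 0 -> tends u l -> tends (fun n => / u n) (/ l).
Proof.
  intros Hl Hu. apply tends_eps; intros eps Heps.
  assert (Hd := proj1 (Cmod_gt_0 l) Hl).
  assert (Hd2 : (0 < Cmod l * Cmod l / 2 * eps)%R).
  { apply Rmult_lt_0_compat; [nra | assumption]. }
  destruct (proj1 (tends_eps u l) Hu (Cmod l / 2)%R ltac:(lra)) as [N1 H1].
  destruct (proj1 (tends_eps u l) Hu _ Hd2) as [N2 H2].
  exists (N1 + N2)%nat; intros n Hn.
  specialize (H1 n ltac:(lia)). specialize (H2 n ltac:(lia)).
  assert (Hun : (Cmod l / 2 < Cmod (u n))%R).
  { assert (T := Cmod_triangle (u n) (- (u n - l))).
    replace (u n + - (u n - l)) with l in T by ring.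
    rewrite Cmod_opp in T. lra. }
  assert (Hu0 : u n <> 0) by (apply Cmod_gt_0; lra).
  replace (/ u n - / l) with (- ((u n - l) / (u n * l))) by (field; auto).
  rewrite Cmod_opp, Cmod_div, Cmod_mult by (apply Cmult_neq_0; assumption).
  apply Rmult_lt_reg_r with (Cmod (u n) * Cmod l)%R; [nra |].
  unfold Rdiv. rewrite Rmult_assoc, Rinv_l, Rmult_1_r by nra.
  eapply Rlt_le_trans; [exact H2 |].
  replace (Cmod l * Cmod l / 2 * eps)%R with (eps * (Cmod l / 2 * Cmod l))%R by field.
  apply Rmult_le_compat_l; [lra |]. nra.
Qed.

Lemma tends_bound (u : nat -> C) (l : C) (K : R) :
  tends u l -> (forall n, (Cmod (u n) <= K)%R) -> (Cmod l <= K)%R.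
Proof.
  intros Hu HK. apply le_epsilon; intros eps Heps.
  destruct (proj1 (tends_eps u l) Hu eps Heps) as [N HN].
  specialize (HN N (le_n N)). specialize (HK N).
  assert (T := Cmod_triangle (u N) (- (u N - l))).
  replace (u N + - (u N - l)) with l in T by ring.
  rewrite Cmod_opp in T. lra.
Qed.

Lemma CLim_seq_tends (u : nat -> C) (l : C) : tends u l -> CLim_seq u = l.
Proof.
  exact (iota_filterlim_locally (V := C_CompleteNormedModule) u l).
Qed.

Lemma CSeries_is_series (a : nat -> C) (s : C) : is_series a s -> CSeries a = s.
Proof.
  exact (iota_filterlim_locally (V := C_CompleteNormedModule) (sum_n a) s).
Qed.

(** * Finite sums and Tannery's theorem *)

(** [sum_n] with its value typed in [C], where [ring] and [field] operate. *)
Definition csum (a : nat -> C) (n : nat) : C := sum_n a n.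

Lemma csum_S (a : nat -> C) (n : nat) :
  csum a (S n) = csum a n + a (S n).
Proof. exact (sum_Sn a n). Qed.

Lemma csum_O (a : nat -> C) : csum a 0 = a 0%nat.
Proof. exact (sum_O a). Qed.

Lemma csum_plus (a b : nat -> C) (n : nat) :
  csum (fun k => a k + b k) n = csum a n + csum b n.
Proof. exact (sum_n_plus a b n). Qed.

Lemma csum_scal (c : C) (a : nat -> C) (n : nat) :
  csum (fun k => c * a k) n = c * csum a n.
Proof. exact (sum_n_mult_l (K := C_Ring) c a n). Qed.

Lemma csum_shift (a : nat -> C) (n : nat) :
  csum a (S n) = a 0%nat + csum (fun k => a (S k)) n.
Proof.
  induction n as [|n IH].
  - rewrite csum_S, !csum_O. reflexivity.
  - rewrite csum_S, IH, csum_S. ring.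
Qed.

Lemma csum_reverse (a : nat -> C) (n : nat) :
  csum (fun k => a (n - k)%nat) n = csum a n.
Proof.
  induction n as [|n IH]; [rewrite !csum_O; reflexivity|].
  rewrite csum_shift, csum_S, <- IH, Nat.sub_0_r. cbn [Nat.sub]. ring.
Qed.

Lemma csum_ext (a b : nat -> C) (n : nat) :
  (forall k, (k <= n)%nat -> a k = b k) -> csum a n = csum b n.
Proof. exact (sum_n_ext_loc a b n). Qed.

(** Reading the terms in pairs, outwards from the middle. *)
Lemma csum_fold (h : nat -> C) (n : nat) :
  csum h (n + S n) = csum (fun k => h (n - k)%nat + h (n + S k)%nat) n.
Proof.
  rewrite csum_plus, csum_reverse.
  assert (H : forall m, csum h (n + S m) = csum h n + csum (fun k => h (n + S k)%nat) m).
  { induction m as [|m IH].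
    - rewrite Nat.add_1_r, csum_S, csum_O, Nat.add_1_r. reflexivity.
    - rewrite Nat.add_succ_r, csum_S, IH, (csum_S _ m), !Nat.add_succ_r. ring. }
  apply H.
Qed.

Lemma tends_sum_n (f : nat -> nat -> C) (g : nat -> C) (K : nat) :
  (forall n, tends (fun N => f N n) (g n)) ->
  tends (fun N => csum (f N) K) (csum g K).
Proof.
  intros Hf. induction K as [|K IH].
  - rewrite csum_O. apply (tends_ext (fun N => f N 0%nat)); [|apply Hf].
    intros N; symmetry; apply csum_O.
  - rewrite csum_S. apply (tends_ext (fun N => csum (f N) K + f N (S K))).
    + intros N; symmetry; apply csum_S.
    + apply tends_plus; [exact IH | apply Hf].
Qed.

Definition dominated (a : nat -> C) : Prop :=
  exists b : nat -> R, ex_series b /\ forall n, (Cmod (a n) <= b n)%R.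

Lemma dominated_ex_series (a : nat -> C) :
  dominated a -> exists s : C, is_series a s.
Proof.
  intros [b [Hb Hab]].
  exact (ex_series_le (V := C_CompleteNormedModule) a b Hab Hb).
Qed.

Lemma dominated_CSeries (a : nat -> C) :
  dominated a -> is_series a (CSeries a).
Proof.
  intros H. destruct (dominated_ex_series a H) as [s Hs].
  rewrite (CSeries_is_series a s Hs). exact Hs.
Qed.

Lemma dominated_geometric (a : nat -> C) (K r : R) :
  (0 <= r < 1)%R -> (forall n, (Cmod (a n) <= K * r ^ n)%R) -> dominated a.
Proof.
  intros Hr Ha. exists (fun n => (K * r ^ n)%R). split; [|exact Ha].
  apply (ex_series_scal_l (K := R_AbsRing) K (fun n => (r ^ n)%R)).
  apply ex_series_geom. rewrite Rabs_pos_eq; lra.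
Qed.

Lemma dominated_plus (u v : nat -> C) :
  dominated u -> dominated v -> dominated (fun n => u n + v n).
Proof.
  intros [b [Hb Hu]] [c [Hc Hv]]. exists (fun n => (b n + c n)%R). split.
  - exact (ex_series_plus (K := R_AbsRing) b c Hb Hc).
  - intros n. eapply Rle_trans; [apply Cmod_triangle|].
    apply Rplus_le_compat; auto.
Qed.

(** Tannery's theorem for a weighted series: the sum is cut at a rank beyond
    which the dominating series contributes less than the tolerance, and the
    finitely many remaining terms converge one by one. *)
Lemma tannery (a : nat -> C) (w : nat -> nat -> C) (W s : C) (K : R) :
  dominated a -> is_series a s ->
  (forall n, tends (fun N => w N n) W) ->
  (forall N n, (Cmod (w N n) <= K)%R) ->
  tends (fun N => csum (fun n => a n * w N n) N) (s * W).
Proof.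
  intros [b [Hb Hab]] Hs Hw HK.
  assert (HW : (Cmod W <= K)%R).
  { apply (tends_bound (fun N => w N 0%nat)); auto. }
  assert (HK0 : (0 <= K)%R) by (eapply Rle_trans; [apply Cmod_ge_0 | exact HW]).
  apply tends_eps; intros eps Heps.
  assert (Hd : (0 < eps / (4 * (K + 1)))%R)
    by (apply Rdiv_lt_0_compat; lra).
  destruct (Cauchy_ex_series b Hb (mkposreal _ Hd)) as [M HM].
  (* [M] is the cut; the weights are bounded by [K], hence a tail by [eps / 4] *)
  assert (Htail : forall (v : nat -> C) (N : nat), (M <= N)%nat ->
            (forall n, (Cmod (v n) <= K)%R) ->
            (Cmod (sum_n_m (fun n => (a n * v n)%C) (S M) N) <= eps / 4)%R).
  { intros v N HN Hv.
    destruct (Nat.eq_dec M N) as [->|HMN].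
    { rewrite sum_n_m_zero by lia. change (Cmod 0 <= eps / 4)%R.
      rewrite Cmod_0; lra. }
    apply Rle_trans with (sum_n_m (fun n => K * b n)%R (S M) N).
    { eapply Rle_trans.
      - exact (norm_sum_n_m (V := C_NormedModule) (fun n => a n * v n) (S M) N).
      - apply sum_n_m_le. intros k. change (Cmod (a k * v k) <= K * b k)%R.
        rewrite Cmod_mult, Rmult_comm.
        apply Rmult_le_compat; try apply Cmod_ge_0; auto. }
    replace (sum_n_m (fun n => K * b n)%R (S M) N) with (K * sum_n_m b (S M) N)%R
      by (symmetry; exact (sum_n_m_mult_l (K := R_Ring) K b (S M) N)).
    specialize (HM (S M) N ltac:(lia) ltac:(lia)). simpl in HM.
    change (Rabs (sum_n_m b (S M) N) < eps / (4 * (K + 1)))%R in HM.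
    apply Rabs_def2 in HM.
    apply Rle_trans with ((K + 1) * (eps / (4 * (K + 1))))%R.
    - apply Rle_trans with (K * (eps / (4 * (K + 1))))%R; [|nra].
      apply Rmult_le_compat_l; lra.
    - apply Req_le; field; lra. }
  assert (Hsplit : forall (v : nat -> C) (N : nat), (M <= N)%nat ->
            csum (fun n => a n * v n) N =
            csum (fun n => a n * v n) M +
            sum_n_m (fun n => a n * v n) (S M) N).
  { intros v N HN. unfold csum, sum_n.
    exact (sum_n_m_Chasles (fun n => a n * v n) 0 M N ltac:(lia) HN). }
  assert (HfW : tends (fun N => csum (fun n => a n * W) N) (s * W)).
  { apply (tends_ext (fun N => csum a N * W)).
    - intros N. symmetry. exact (sum_n_mult_r (K := C_Ring) W a N).
    - apply tends_mult; [exact Hs | apply tends_const]. }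
  assert (Hhead : tends (fun N => csum (fun n => a n * w N n) M)
                        (csum (fun n => a n * W) M)).
  { apply (tends_sum_n (fun N n => a n * w N n)). intros n.
    apply tends_mult; [apply tends_const | apply Hw]. }
  destruct (proj1 (tends_eps _ _) HfW (eps / 4)%R ltac:(lra)) as [N1 H1].
  destruct (proj1 (tends_eps _ _) Hhead (eps / 4)%R ltac:(lra)) as [N2 H2].
  exists (M + N1 + N2)%nat; intros N HN.
  specialize (H1 N ltac:(lia)). specialize (H2 N ltac:(lia)).
  assert (T1 := Htail (w N) N ltac:(lia) (HK N)).
  assert (T2 := Htail (fun _ => W) N ltac:(lia) (fun _ => HW)).
  cbv beta in T2.
  rewrite (Hsplit (fun _ => W) N ltac:(lia)) in H1.
  rewrite (Hsplit (w N) N ltac:(lia)).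
  set (A := csum (fun n => a n * w N n) M) in *.
  set (A' := csum (fun n => a n * W) M) in *.
  set (B := sum_n_m (fun n => a n * w N n) (S M) N) in *.
  set (B' := sum_n_m (fun n => a n * W) (S M) N) in *.
  change (Cmod (A + B - s * W) < eps)%R.
  replace (A + B - s * W) with ((A - A') + (B + (- B' + (A' + B' - s * W)))) by ring.
  eapply Rle_lt_trans; [apply Cmod_triangle|].
  assert (U := Cmod_triangle B (- B' + (A' + B' - s * W))).
  assert (V := Cmod_triangle (- B') (A' + B' - s * W)).
  rewrite Cmod_opp in V.
  change (Cmod (A' + B' - s * W) < eps / 4)%R in H1.
  lra.
Qed.

(** * Infinite q-products *)

(** Since 1 + x <= exp x, the factors multiply to at most the exponential of a
    geometric sum. *)
Lemma geometric_product_bound (u : nat -> R) (c r : R) :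
  (0 <= r < 1)%R -> (0 <= c)%R -> (forall n, (0 <= u n)%R) ->
  (forall n, (u (S n) <= u n * (1 + c * r ^ n))%R) ->
  forall n, (u n <= u 0%nat * exp (c / (1 - r)))%R.
Proof.
  intros Hr Hc Hu Hrec.
  assert (H : forall n, (u n <= u 0%nat * exp (c * (1 - r ^ n) / (1 - r)))%R).
  { induction n as [|n IH].
    - simpl. replace (c * (1 - 1) / (1 - r))%R with 0%R by (field; lra).
      rewrite exp_0; lra.
    - eapply Rle_trans; [apply Hrec|].
      assert (Hrn : (0 <= c * r ^ n)%R)
        by (apply Rmult_le_pos; [lra | apply pow_le; lra]).
      replace (c * (1 - r ^ S n) / (1 - r))%R
        with (c * (1 - r ^ n) / (1 - r) + c * r ^ n)%R by (simpl; field; lra).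
      rewrite exp_plus, <- Rmult_assoc.
      apply Rmult_le_compat; [apply Hu | lra | exact IH | apply exp_ineq1_le]. }
  intros n. eapply Rle_trans; [apply H|].
  apply Rmult_le_compat_l; [apply Hu|].
  assert (Hle : (c * (1 - r ^ n) / (1 - r) <= c / (1 - r))%R).
  { apply Rmult_le_compat_r; [left; apply Rinv_0_lt_compat; lra|].
    assert (Hp : (0 <= r ^ n)%R) by (apply pow_le; lra). nra. }
  destruct Hle as [Hlt|Heq].
  - left. apply exp_increasing. exact Hlt.
  - rewrite Heq. apply Rle_refl.
Qed.

Lemma Cmod_pow_lt_1 (q : C) (n : nat) : (Cmod q < 1)%R -> (Cmod (q ^ S n) < 1)%R.
Proof.
  intros Hq. rewrite Cmod_pow.
  apply (pow_lt_1_compat (Cmod q) (S n)); [|lia].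
  split; [apply Cmod_ge_0 | exact Hq].
Qed.

Lemma Cmod_pow_le_1 (q : C) (n : nat) : (Cmod q <= 1)%R -> (Cmod (q ^ n) <= 1)%R.
Proof.
  intros Hq. rewrite Cmod_pow. rewrite <- (pow1 n).
  apply pow_incr. split; [apply Cmod_ge_0 | exact Hq].
Qed.

Lemma one_minus_neq_0 (z : C) : (Cmod z < 1)%R -> 1 - z <> 0.
Proof.
  intros Hz H. assert (E : z = 1) by (rewrite <- (Cplus_0_r z), <- H; ring).
  rewrite E, Cmod_1 in Hz. lra.
Qed.

Lemma Cmod_mul_pow_lt_1 (a q : C) (n : nat) :
  (Cmod a < 1)%R -> (Cmod q < 1)%R -> (Cmod (a * q ^ n) < 1)%R.
Proof.
  intros Ha Hq. rewrite Cmod_mult.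
  assert (H := Cmod_pow_le_1 q n (Rlt_le _ _ Hq)).
  assert (H0 := Cmod_ge_0 a). assert (H1 := Cmod_ge_0 (q ^ n)). nra.
Qed.

Lemma qpoch_neq_0 (a q : C) (n : nat) :
  (Cmod a < 1)%R -> (Cmod q < 1)%R -> qpoch a q n <> 0.
Proof.
  intros Ha Hq. induction n as [|n IH]; simpl.
  - exact C1_nz.
  - apply Cmult_neq_0; [exact IH |].
    apply one_minus_neq_0, Cmod_mul_pow_lt_1; assumption.
Qed.

Lemma qpoch_bounded (a q : C) :
  (Cmod q < 1)%R -> exists K : R, forall n, (Cmod (qpoch a q n) <= K)%R.
Proof.
  intros Hq. eexists. 
  apply (geometric_product_bound _ (Cmod a) (Cmod q)).
  - split; [apply Cmod_ge_0 | exact Hq].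
  - apply Cmod_ge_0.
  - intros n; apply Cmod_ge_0.
  - intros n. simpl. rewrite Cmod_mult. apply Rmult_le_compat_l; [apply Cmod_ge_0|].
    eapply Rle_trans; [apply Cmod_triangle|].
    rewrite Cmod_1, Cmod_opp, Cmod_mult, Cmod_pow. apply Rle_refl.
Qed.

(** The reciprocal of a factor is 1 + x / (1 - x) with x = |a q^n| at most |a|, so
    the reciprocals too grow like 1 + c |q|^n. This bound gives both the weights of
    Tannery's theorem and the nonvanishing of infinite products. *)
Lemma qpoch_inv_bounded (a q : C) :
  (Cmod a < 1)%R -> (Cmod q < 1)%R ->
  exists K : R, forall n, (Cmod (/ qpoch a q n) <= K)%R.
Proof.
  intros Ha Hq. eexists.
  apply (geometric_product_bound _ (Cmod a / (1 - Cmod a)) (Cmod q)).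
  - split; [apply Cmod_ge_0 | exact Hq].
  - apply Rdiv_le_0_compat; [apply Cmod_ge_0 | lra].
  - intros n; apply Cmod_ge_0.
  - intros n. simpl.
    assert (Hx := Cmod_mul_pow_lt_1 a q n Ha Hq).
    assert (H1 := one_minus_neq_0 _ Hx).
    assert (H0 := qpoch_neq_0 a q n Ha Hq).
    replace (/ (qpoch a q n * (1 - a * q ^ n)))
      with (/ qpoch a q n * / (1 - a * q ^ n)) by (field; split; assumption).
    rewrite Cmod_mult, (Cmod_inv (1 - _)) by assumption.
    apply Rmult_le_compat_l; [apply Cmod_ge_0|].
    assert (T := Cmod_triangle (1 - a * q ^ n) (a * q ^ n)).
    replace (1 - a * q ^ n + a * q ^ n) with (RtoC 1) in T by ring.
    rewrite Cmod_1 in T.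
    assert (Hle : (Cmod (a * q ^ n) <= Cmod a)%R).
    { rewrite Cmod_mult. assert (H := Cmod_pow_le_1 q n (Rlt_le _ _ Hq)).
      assert (U := Cmod_ge_0 a). nra. }
    replace (Cmod a / (1 - Cmod a) * Cmod q ^ n)%R
      with (Cmod (a * q ^ n) / (1 - Cmod a))%R
      by (rewrite Cmod_mult, Cmod_pow; field; lra).
    set (x := Cmod (a * q ^ n)) in *.
    assert (Hx0 : (0 <= x)%R) by apply Cmod_ge_0.
    apply Rle_trans with (/ (1 - x))%R.
    { apply Rinv_le_contravar; lra. }
    apply Rle_trans with (1 + x / (1 - x))%R.
    { apply Req_le; field; lra. }
    apply Rplus_le_compat_l. apply Rmult_le_compat_l; [exact Hx0|].
    apply Rinv_le_contravar; lra.
Qed.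

Lemma qpoch_tends (a q : C) :
  (Cmod q < 1)%R -> tends (qpoch a q) (qpoch_inf a q).
Proof.
  intros Hq. destruct (qpoch_bounded a q Hq) as [K HK].
  destruct (dominated_ex_series (fun n => qpoch a q n * (- (a * q ^ n))))
    as [s Hs].
  { apply dominated_geometric with (K := (K * Cmod a)%R) (r := Cmod q).
    - split; [apply Cmod_ge_0 | exact Hq].
    - intros n. rewrite Cmod_mult, Cmod_opp, Cmod_mult, Cmod_pow, <- Rmult_assoc.
      apply Rmult_le_compat_r; [apply pow_le, Cmod_ge_0|].
      apply Rmult_le_compat_r; [apply Cmod_ge_0 | apply HK]. }
  assert (Hl : tends (qpoch a q) (1 + s)).
  { (* the partial products are the partial sums of their increments *)
    apply (proj2 (tends_eps _ _)). intros eps Heps.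
    destruct (proj1 (tends_eps _ _) Hs eps Heps) as [N HN].
    exists (S N). intros [|n] Hn; [lia|].
    replace (qpoch a q (S n))
      with (1 + csum (fun k => qpoch a q k * (- (a * q ^ k))) n).
    - replace (1 + _ - (1 + s))
        with (csum (fun k => qpoch a q k * (- (a * q ^ k))) n - s) by ring.
      apply HN. lia.
    - clear Hn. induction n as [|n IH].
      + rewrite csum_O. simpl. ring.
      + rewrite csum_S, Cplus_assoc, IH. simpl. ring. }
  replace (qpoch_inf a q) with (1 + s); [exact Hl|].
  symmetry. exact (CLim_seq_tends _ _ Hl).
Qed.

Lemma qpoch_inf_neq_0 (a q : C) :
  (Cmod a < 1)%R -> (Cmod q < 1)%R -> qpoch_inf a q <> 0.
Proof.
  intros Ha Hq H. destruct (qpoch_inv_bounded a q Ha Hq) as [K HK].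
  assert (Ht := qpoch_tends a q Hq).
  assert (HK0 : (0 < K)%R).
  { specialize (HK 0%nat). simpl in HK. rewrite Cmod_inv, Cmod_1 in HK by exact C1_nz. lra. }
  destruct (proj1 (tends_eps _ _) Ht (/ K)%R ltac:(apply Rinv_0_lt_compat; lra))
    as [N HN].
  specialize (HN N (le_n N)). specialize (HK N).
  rewrite H in HN. replace (qpoch a q N - 0) with (qpoch a q N) in HN by ring.
  assert (H0 := qpoch_neq_0 a q N Ha Hq).
  rewrite Cmod_inv in HK by exact H0.
  assert (Hp := proj1 (Cmod_gt_0 _) H0).
  apply Rinv_lt_contravar in HN.
  - rewrite Rinv_inv in HN. lra.
  - apply Rmult_lt_0_compat; [exact Hp | apply Rinv_0_lt_compat; exact HK0].
Qed.

Lemma qpoch_inf_split2 (a q : C) :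
  (Cmod q < 1)%R ->
  qpoch_inf a (q ^ 2) * qpoch_inf (a * q) (q ^ 2) = qpoch_inf a q.
Proof.
  intros Hq. assert (Hq2 := Cmod_pow_lt_1 q 1 Hq).
  apply (tends_unique (fun n => qpoch a q (2 * n))).
  - apply (tends_ext (fun n => qpoch a (q ^ 2) n * qpoch (a * q) (q ^ 2) n)).
    + induction n as [|n IH]; [simpl; ring|].
      replace (2 * S n)%nat with (S (S (2 * n))) by lia. cbn [qpoch].
      rewrite <- IH, <- Cpow_mult_r, (Cpow_S q (2 * n)). ring.
    + apply tends_mult; apply qpoch_tends; exact Hq2.
  - apply (tends_subseq (qpoch a q) _ _ 0); [intros; lia | apply qpoch_tends, Hq].
Qed.

Lemma qpoch_inf_split3 (a q : C) :
  (Cmod q < 1)%R ->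
  qpoch_inf a (q ^ 3) * qpoch_inf (a * q) (q ^ 3) * qpoch_inf (a * q ^ 2) (q ^ 3)
  = qpoch_inf a q.
Proof.
  intros Hq. assert (Hq3 := Cmod_pow_lt_1 q 2 Hq).
  apply (tends_unique (fun n => qpoch a q (3 * n))).
  - apply (tends_ext (fun n => qpoch a (q ^ 3) n * qpoch (a * q) (q ^ 3) n
                               * qpoch (a * q ^ 2) (q ^ 3) n)).
    + induction n as [|n IH]; [simpl; ring|].
      replace (3 * S n)%nat with (S (S (S (3 * n)))) by lia. cbn [qpoch].
      rewrite <- IH, <- Cpow_mult_r, (Cpow_S q (S (3 * n))),
        (Cpow_S q (3 * n)). ring.
    + apply tends_mult; [apply tends_mult|]; apply qpoch_tends; exact Hq3.
  - apply (tends_subseq (qpoch a q) _ _ 0); [intros; lia | apply qpoch_tends, Hq].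
Qed.

Lemma qpoch_mul_opp (a q : C) (n : nat) :
  qpoch a q n * qpoch (- a) q n = qpoch (a ^ 2) (q ^ 2) n.
Proof.
  induction n as [|n IH]; [simpl; ring|]. cbn [qpoch].
  rewrite <- IH, <- Cpow_mult_r, (Nat.mul_comm 2 n), Cpow_mult_r. ring.
Qed.

Lemma qpoch_inf_mul_opp (a q : C) :
  (Cmod q < 1)%R ->
  qpoch_inf a q * qpoch_inf (- a) q = qpoch_inf (a ^ 2) (q ^ 2).
Proof.
  intros Hq. apply (tends_unique (qpoch (a ^ 2) (q ^ 2))).
  - apply (tends_ext (fun n => qpoch a q n * qpoch (- a) q n)).
    + apply qpoch_mul_opp.
    + apply tends_mult; apply qpoch_tends; exact Hq.
  - apply qpoch_tends, Cmod_pow_lt_1, Hq.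
Qed.

(** * Finite form of Jacobi's triple product *)

(** Gaussian binomials, up to their numerator, and the denominators of Bailey
    sums are products of two of these; removing a factor is [qfact_inv_S]. *)
Definition qfact_inv (q : C) (n : nat) : C := / qpoch q q n.

Lemma qfact_inv_S (q : C) (n : nat) :
  (Cmod q < 1)%R -> (1 - q ^ S n) * qfact_inv q (S n) = qfact_inv q n.
Proof.
  intros Hq. unfold qfact_inv. cbn [qpoch].
  assert (H0 := qpoch_neq_0 q q n Hq Hq).
  assert (H1 := one_minus_neq_0 _ (Cmod_pow_lt_1 q n Hq)).
  rewrite Cpow_S in *. field. split; assumption.
Qed.

(** The two q-Pascal rules at once: [alpha] and [beta] say how [1 - q^(m+1)] is
    shared between the two factors, each of which then loses one unit. *)
Lemma q_pascal_sum (q : C) (u alpha beta : nat -> C) (m : nat) :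
  (Cmod q < 1)%R ->
  (forall k, (k <= S m)%nat ->
     alpha k * (1 - q ^ (S m - k)) + beta k * (1 - q ^ k) = 1 - q ^ S m) ->
  (1 - q ^ S m) *
    csum (fun k => u k * (qfact_inv q k * qfact_inv q (S m - k))) (S m) =
  csum (fun k => (alpha k * u k + beta (S k) * u (S k)) *
                  (qfact_inv q k * qfact_inv q (m - k))) m.
Proof.
  intros Hq Hab.
  set (A := fun k => alpha k * u k *
              (qfact_inv q k * ((1 - q ^ (S m - k)) * qfact_inv q (S m - k)))).
  set (B := fun k => beta k * u k *
              ((1 - q ^ k) * qfact_inv q k * qfact_inv q (S m - k))).
  transitivity (csum A (S m) + csum B (S m)).
  { rewrite <- csum_plus, <- csum_scal. apply csum_ext. intros k Hk.
    unfold A, B. rewrite <- (Hab k Hk). ring. }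
  rewrite (csum_S A), (csum_shift B).
  transitivity (csum A m + csum (fun k => B (S k)) m).
  { unfold A at 2, B at 1. rewrite Nat.sub_diag. cbn [Cpow]. ring. }
  rewrite <- csum_plus. apply csum_ext. intros k Hk. unfold A, B.
  replace (S m - k)%nat with (S (m - k)) by lia.
  rewrite !qfact_inv_S by exact Hq. cbn [Nat.sub]. ring.
Qed.

Lemma theta_term_0 (a b : C) : theta_term a b 0 = 1.
Proof. unfold theta_term. simpl. ring. Qed.

Lemma theta_term_pos_S (a b : C) (n : nat) :
  theta_term a b (Z.of_nat (S n)) =
  theta_term a b (Z.of_nat n) * (a * (a * b) ^ n).
Proof.
  unfold theta_term. set (z := Z.of_nat n).
  replace (Z.of_nat (S n)) with (z + 1)%Z by (unfold z; lia).
  replace ((z + 1) * (z + 1 + 1))%Z with (z * (z + 1) + (z + 1) * 2)%Z by ring.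
  replace ((z + 1) * (z + 1 - 1))%Z with (z * (z - 1) + z * 2)%Z by ring.
  rewrite !Z.div_add by lia.
  assert (H1 : (0 <= z * (z + 1) / 2)%Z) by (apply Z.div_pos; lia || nia).
  assert (H2 : (0 <= z * (z - 1) / 2)%Z).
  { apply Z.div_pos; [|lia]. unfold z. destruct n; nia. }
  rewrite (Z2Nat.inj_add (z * (z + 1) / 2)), (Z2Nat.inj_add (z * (z - 1) / 2)) by lia.
  replace (Z.to_nat (z + 1)) with (S n) by lia.
  replace (Z.to_nat z) with n by lia.
  rewrite !Cpow_add_r, Cpow_S, Cpow_mult_l. ring.
Qed.

Lemma theta_term_swap (a b : C) (z : Z) :
  theta_term a b (- z) = theta_term b a z.
Proof.
  unfold theta_term. rewrite Cmult_comm.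
  replace (- z * (- z + 1))%Z with (z * (z - 1))%Z by ring.
  replace (- z * (- z - 1))%Z with (z * (z + 1))%Z by ring.
  reflexivity.
Qed.

Lemma theta_term_neg_S (a b : C) (n : nat) :
  theta_term a b (- Z.of_nat (S n)) =
  theta_term a b (- Z.of_nat n) * (b * (a * b) ^ n).
Proof.
  rewrite !theta_term_swap, theta_term_pos_S, (Cmult_comm b a). reflexivity.
Qed.

(** The two recurrences of [theta_term] in one formula free of negative powers. *)
Lemma theta_term_succ (a b : C) (z : Z) (M : nat) :
  (z <= Z.of_nat M)%Z ->
  (a * b) ^ Z.to_nat (Z.of_nat M - z) * theta_term a b (z + 1) =
  a * (a * b) ^ M * theta_term a b z.
Proof.
  intros Hz. destruct (Z_le_gt_dec 0 z) as [Hp|Hn].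
  - rewrite <- (Z2Nat.id z) by exact Hp. set (n := Z.to_nat z) in *.
    replace (Z.of_nat n + 1)%Z with (Z.of_nat (S n)) by lia.
    rewrite theta_term_pos_S.
    replace M with (Z.to_nat (Z.of_nat M - Z.of_nat n) + n)%nat at 2 by lia.
    rewrite Cpow_add_r. ring.
  - set (n := Z.to_nat (- z - 1)).
    replace (z + 1)%Z with (- Z.of_nat n)%Z by lia.
    replace (theta_term a b z) with (theta_term a b (- Z.of_nat (S n)))
      by (f_equal; lia).
    rewrite theta_term_neg_S.
    replace (Z.to_nat (Z.of_nat M - z)) with (M + n + 1)%nat by lia.
    rewrite !Cpow_add_r. cbn [Cpow]. ring.
Qed.

Lemma theta_term_pred (a b : C) (z : Z) (N : nat) :
  (- Z.of_nat N <= z)%Z ->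
  (a * b) ^ Z.to_nat (Z.of_nat N + z) * theta_term a b (z - 1) =
  b * (a * b) ^ N * theta_term a b z.
Proof.
  intros Hz. rewrite <- (Z.opp_involutive z), (theta_term_swap a b (- z)).
  replace (- - z - 1)%Z with (- (- z + 1))%Z by ring.
  rewrite (theta_term_swap a b (- z + 1)), (Cmult_comm a b).
  rewrite <- theta_term_succ by lia. reflexivity.
Qed.

(** The sum is the bilateral one over z = k - N, from -N to M. Adding a factor to
    the first product is one q-Pascal rule, adding a factor to the second one is
    the other, and in both cases the shifted theta term is absorbed by the
    recurrence of [theta_term]. *)
Lemma finite_triple_product (a b : C) (M N : nat) :
  (Cmod (a * b) < 1)%R ->
  csum (fun k => theta_term a b (Z.of_nat k - Z.of_nat N) *
           (qfact_inv (a * b) k * qfact_inv (a * b) (M + N - k))) (M + N) =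
  qpoch (- a) (a * b) M * qpoch (- b) (a * b) N * qfact_inv (a * b) (M + N).
Proof.
  intros HQ. set (Q := a * b) in *.
  assert (Hstep : forall m (x y c : C),
            (1 - Q ^ S m) * x = c * (y * qfact_inv Q m) ->
            x = y * c * qfact_inv Q (S m)).
  { intros m x y c H.
    assert (H1 := one_minus_neq_0 _ (Cmod_pow_lt_1 Q m HQ)).
    rewrite <- (qfact_inv_S Q m HQ) in H.
    replace x with (((1 - Q ^ S m) * x) / (1 - Q ^ S m)) by (field; exact H1).
    rewrite H. field. exact H1. }
  induction M as [|M IHM].
  - induction N as [|N IHN].
    + rewrite csum_O. simpl. unfold qfact_inv. simpl.
      rewrite theta_term_0. field.
    + cbn [Nat.add qpoch] in *. rewrite Cmult_assoc. apply Hstep.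
      rewrite (q_pascal_sum Q _ (fun k => Q ^ k) (fun _ => 1)).
      * rewrite <- IHN, <- csum_scal. apply csum_ext. intros k Hk.
        assert (T := theta_term_pred a b (Z.of_nat k - Z.of_nat N) N ltac:(lia)).
        replace (Z.to_nat (Z.of_nat N + (Z.of_nat k - Z.of_nat N))) with k in T by lia.
        replace (Z.of_nat k - Z.of_nat N - 1)%Z
          with (Z.of_nat k - Z.of_nat (S N))%Z in T by lia.
        replace (Z.of_nat (S k) - Z.of_nat (S N))%Z
          with (Z.of_nat k - Z.of_nat N)%Z by lia.
        fold Q in T. rewrite T. ring.
      * exact HQ.
      * intros k Hk. replace (S N) with (S N - k + k)%nat at 2 by lia.
        rewrite Cpow_add_r. ring.
  - cbn [Nat.add qpoch] in *.
    replace (qpoch (- a) Q M * (1 - - a * Q ^ M) * qpoch (- b) Q N)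
      with (qpoch (- a) Q M * qpoch (- b) Q N * (1 - - a * Q ^ M)) by ring.
    apply Hstep.
    rewrite (q_pascal_sum Q _ (fun _ => 1) (fun k => Q ^ (S (M + N) - k))).
    + rewrite <- IHM, <- csum_scal. apply csum_ext. intros k Hk.
      assert (T := theta_term_succ a b (Z.of_nat k - Z.of_nat N) M ltac:(lia)).
      replace (Z.to_nat (Z.of_nat M - (Z.of_nat k - Z.of_nat N)))
        with (M + N - k)%nat in T by lia.
      replace (Z.of_nat k - Z.of_nat N + 1)%Z
        with (Z.of_nat (S k) - Z.of_nat N)%Z in T by lia.
      fold Q in T. cbn [Nat.sub]. rewrite T. ring.
    + exact HQ.
    + intros k Hk. replace (S (M + N)) with (S (M + N) - k + k)%nat at 3 by lia.
      rewrite Cpow_add_r. ring.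
Qed.

(** With as many z >= 0 as z < 0, the terms z = n and z = -n-1 carry the same two
    q-factorials; this is the shape in which Bailey sums arise. *)
Lemma finite_triple_product_folded (a b : C) (N : nat) :
  (Cmod (a * b) < 1)%R ->
  csum (fun n => (theta_term a b (Z.of_nat n) + theta_term a b (- Z.of_nat (S n))) *
           (qfact_inv (a * b) (N - n) * qfact_inv (a * b) (N + S n))) N =
  qpoch (- a) (a * b) N * qpoch (- b) (a * b) (S N) * qfact_inv (a * b) (N + S N).
Proof.
  intros HQ. rewrite <- finite_triple_product, csum_fold by exact HQ.
  apply csum_ext. intros k Hk.
  replace (N + S N - (N - k))%nat with (N + S k)%nat by lia.
  replace (N + S N - (N + S k))%nat with (N - k)%nat by lia.
  replace (Z.of_nat (N - k) - Z.of_nat (S N))%Z with (- Z.of_nat (S k))%Z by lia.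
  replace (Z.of_nat (N + S k) - Z.of_nat (S N))%Z with (Z.of_nat k) by lia.
  ring.
Qed.

(** * Jacobi's triple product in the limit *)

Lemma theta_term_pos_bound (a b : C) (n : nat) :
  (Cmod a < 1)%R -> (Cmod b < 1)%R ->
  (Cmod (theta_term a b (Z.of_nat n)) <= Cmod a ^ n)%R.
Proof.
  intros Ha Hb. induction n as [|n IH].
  - rewrite theta_term_0, Cmod_1. simpl. lra.
  - rewrite theta_term_pos_S, !Cmod_mult. simpl (Cmod a ^ S n)%R.
    rewrite Rmult_comm.
    assert (HQ : (Cmod (a * b) <= 1)%R).
    { rewrite Cmod_mult. assert (H1 := Cmod_ge_0 a). assert (H2 := Cmod_ge_0 b). nra. }
    assert (H := Cmod_pow_le_1 _ n HQ). assert (H1 := Cmod_ge_0 a).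
    assert (H2 := Cmod_ge_0 ((a * b) ^ n)).
    apply Rmult_le_compat; [nra | apply Cmod_ge_0 | nra | exact IH].
Qed.

Lemma theta_pos_dominated (a b : C) :
  (Cmod a < 1)%R -> (Cmod b < 1)%R ->
  dominated (fun n => theta_term a b (Z.of_nat n)).
Proof.
  intros Ha Hb. apply (dominated_geometric _ 1 (Cmod a)).
  - split; [apply Cmod_ge_0 | exact Ha].
  - intros n. rewrite Rmult_1_l. apply theta_term_pos_bound; assumption.
Qed.

Lemma theta_neg_dominated (a b : C) :
  (Cmod a < 1)%R -> (Cmod b < 1)%R ->
  dominated (fun n => theta_term a b (- Z.of_nat (S n))).
Proof.
  intros Ha Hb. apply (dominated_geometric _ 1 (Cmod b)).
  - split; [apply Cmod_ge_0 | exact Hb].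
  - intros n. rewrite Rmult_1_l, theta_term_swap.
    eapply Rle_trans; [apply theta_term_pos_bound; assumption|].
    simpl. assert (H := Cmod_ge_0 b).
    assert (H1 : (0 <= Cmod b ^ n)%R) by (apply pow_le, H). nra.
Qed.

Lemma ramanujan_f_series (a b : C) :
  (Cmod a < 1)%R -> (Cmod b < 1)%R ->
  is_series (fun n => theta_term a b (Z.of_nat n) + theta_term a b (- Z.of_nat (S n)))
    (ramanujan_f a b).
Proof.
  intros Ha Hb.
  exact (is_series_plus _ _ _ _
           (dominated_CSeries _ (theta_pos_dominated a b Ha Hb))
           (dominated_CSeries _ (theta_neg_dominated a b Ha Hb))).
Qed.

Lemma qfact_inv_tends (q : C) :
  (Cmod q < 1)%R -> tends (qfact_inv q) (/ qpoch_inf q q).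
Proof.
  intros Hq. apply tends_inv; [apply qpoch_inf_neq_0 | apply qpoch_tends]; exact Hq.
Qed.

(** The sums in [finite_triple_product_folded] and on the right of the finite
    identity for the theorem have this shape: the weight of each fixed term tends
    to the same limit. *)
Lemma folded_sum_tends (q : C) (c : nat -> C) (s : C) :
  (Cmod q < 1)%R -> dominated c -> is_series c s ->
  tends (fun N => csum (fun n => c n * (qfact_inv q (N - n) * qfact_inv q (N + S n))) N)
    (s * (/ qpoch_inf q q * / qpoch_inf q q)).
Proof.
  intros Hq Hc Hs. destruct (qpoch_inv_bounded q q Hq Hq) as [K HK].
  apply (tannery c (fun N n => qfact_inv q (N - n) * qfact_inv q (N + S n)) _ s (K * K));
    [exact Hc | exact Hs | |].
  - intros n. assert (H := qfact_inv_tends q Hq). apply tends_mult.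
    + apply (tends_subseq _ _ (fun N => N - n)%nat n); [intros; lia | exact H].
    + apply (tends_subseq _ _ (fun N => N + S n)%nat 0); [intros; lia | exact H].
  - intros N n. rewrite Cmod_mult.
    apply Rmult_le_compat; try apply Cmod_ge_0; apply HK.
Qed.

(** The folded finite identity tends to this one: its left side to
    [ramanujan_f a b] over the square of (ab;ab)_oo, its right side to the first
    two products over (ab;ab)_oo. *)
Lemma jacobi_triple_product (a b : C) :
  (Cmod a < 1)%R -> (Cmod b < 1)%R ->
  ramanujan_f a b =
  qpoch_inf (- a) (a * b) * qpoch_inf (- b) (a * b) * qpoch_inf (a * b) (a * b).
Proof.
  intros Ha Hb.
  assert (HQ : (Cmod (a * b) < 1)%R).
  { rewrite Cmod_mult. assert (H1 := Cmod_ge_0 a). assert (H2 := Cmod_ge_0 b). nra. }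
  set (Q := a * b) in *.
  assert (HE := qpoch_inf_neq_0 Q Q HQ HQ).
  assert (L := folded_sum_tends Q _ _ HQ
    (dominated_plus _ _ (theta_pos_dominated a b Ha Hb) (theta_neg_dominated a b Ha Hb))
    (ramanujan_f_series a b Ha Hb)).
  assert (R : tends (fun N => qpoch (- a) Q N * qpoch (- b) Q (S N) * qfact_inv Q (N + S N))
    (qpoch_inf (- a) Q * qpoch_inf (- b) Q * / qpoch_inf Q Q)).
  { apply tends_mult; [apply tends_mult|].
    - apply qpoch_tends, HQ.
    - apply (tends_subseq _ _ S 0); [intros; lia | apply qpoch_tends, HQ].
    - apply (tends_subseq _ _ (fun N => N + S N)%nat 0);
        [intros; lia | apply qfact_inv_tends, HQ]. }
  assert (E : ramanujan_f a b * (/ qpoch_inf Q Q * / qpoch_inf Q Q) =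
              qpoch_inf (- a) Q * qpoch_inf (- b) Q * / qpoch_inf Q Q).
  { eapply tends_unique; [exact L|].
    eapply tends_ext; [|exact R]. intros N. symmetry.
    apply (finite_triple_product_folded a b N HQ). }
  replace (ramanujan_f a b)
    with (ramanujan_f a b * (/ qpoch_inf Q Q * / qpoch_inf Q Q)
          * (qpoch_inf Q Q * qpoch_inf Q Q)) by (field; exact HE).
  rewrite E. field. exact HE.
Qed.

Lemma ramanujan_f_comm (a b : C) :
  (Cmod a < 1)%R -> (Cmod b < 1)%R -> ramanujan_f a b = ramanujan_f b a.
Proof.
  intros Ha Hb. rewrite !jacobi_triple_product, (Cmult_comm b a) by assumption. ring.
Qed.

(** * A Bailey pair and one step of the Bailey lemma *)

(** The Bailey pair relative to a = p with beta_n = 1 / (p^2;p^2)_n and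
    alpha_r = (-1)^r p^(r^2) (1 - p^(2r+1)) / (1 - p). Wilf-Zeilberger proof: the
    recurrence (1 - p^(2n+2)) beta_(n+1) = beta_n holds because its summand is a
    difference in r of the explicit sequence on the right of [Htel]. *)
Lemma bailey_pair_sum (p : C) (n : nat) :
  (Cmod p < 1)%R ->
  csum (fun r => (- (1)) ^ r * p ^ (r * r) * (1 - p ^ (r + S r)) *
                 (qfact_inv p (n - r) * qfact_inv p (n + S r))) n =
  / qpoch (p ^ 2) (p ^ 2) n.
Proof.
  intros Hp. set (e := qfact_inv p).
  assert (He : forall k, (1 - p ^ S k) * e (S k) = e k)
    by (intros k; apply qfact_inv_S, Hp).
  set (F := fun n r => (- (1)) ^ r * p ^ (r * r) * (1 - p ^ (r + S r)) *
                 (e (n - r)%nat * e (n + S r)%nat)).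
  change (csum (F n) n = / qpoch (p ^ 2) (p ^ 2) n).
  (* partial sums of the recurrence, in closed form *)
  assert (Htel : forall n k, (k <= n)%nat ->
    csum (fun r => (1 - p ^ (S n + S n)) * F (S n) r - F n r) k =
    (- (1)) ^ k * p ^ (k * k) * p ^ (S n + k) * (1 - p ^ (S k + S k)) *
      (e (n - k)%nat * e (S n + S k)%nat)).
  { clear n. intros n. induction k as [|k IH]; intros Hk.
    - rewrite csum_O. unfold F. rewrite !Nat.sub_0_r, !Nat.add_1_r, !Nat.add_0_r.
      cbn [Nat.mul Nat.add].
      rewrite <- (He n), <- (He (S n)), Nat.add_succ_r.
      repeat rewrite ?Cpow_add_r, ?Cpow_S. cbn [Cpow]. ring.
    - rewrite csum_S, IH by lia. unfold F.
      assert (Hj : exists j, n = (S k + j)%nat) by (exists (n - S k)%nat; lia).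
      destruct Hj as [j ->].
      replace (S k + j - k)%nat with (S j) by lia.
      replace (S (S k + j) - S k)%nat with (S j) by lia.
      replace (S k + j - S k)%nat with j by lia.
      replace (S (S k + j) + S (S k))%nat with (S (S k + j + S (S k))) by lia.
      replace (S (S k + j) + S k)%nat with (S k + j + S (S k))%nat by lia.
      rewrite <- (He j), <- (He (S k + j + S (S k))%nat).
      replace (S k * S k)%nat with (k * k + k + S k)%nat by ring.
      repeat rewrite ?Cpow_add_r, ?Cpow_S. cbn [Cpow]. ring. }
  assert (Hrec : forall n, (1 - p ^ (S n + S n)) * csum (F (S n)) (S n) = csum (F n) n).
  { clear n. intros n. specialize (Htel n n (le_n n)).
    assert (E : csum (fun r => (1 - p ^ (S n + S n)) * F (S n) r - F n r) n =
                (1 - p ^ (S n + S n)) * csum (F (S n)) n - csum (F n) n).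
    { transitivity (csum (fun r => (1 - p ^ (S n + S n)) * F (S n) r + (- (1)) * F n r) n).
      - apply csum_ext. intros; ring.
      - rewrite csum_plus, !csum_scal. ring. }
    rewrite Htel in E. rewrite csum_S.
    replace (csum (F n) n)
      with ((1 - p ^ (S n + S n)) * csum (F (S n)) n -
            ((1 - p ^ (S n + S n)) * csum (F (S n)) n - csum (F n) n)) by ring.
    (* the closed form at k = n cancels the last term, r = n + 1 *)
    rewrite <- E. unfold F. rewrite !Nat.sub_diag.
    rewrite (Nat.add_succ_r (S n) (S n)), <- (He (S n + S n)%nat).
    replace (S n * S n)%nat with (n * n + n + S n)%nat by ring.
    repeat rewrite ?Cpow_add_r, ?Cpow_S. cbn [Cpow]. ring. }
  assert (Hp2 := Cmod_pow_lt_1 p 1 Hp).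
  induction n as [|n IH].
  - rewrite csum_O. unfold F, e, qfact_inv. cbn.
    assert (H := one_minus_neq_0 p Hp). field.
    intros H'. apply H. rewrite <- H'. ring.
  - assert (H0 := qpoch_neq_0 (p ^ 2) (p ^ 2) n Hp2 Hp2).
    assert (H1 := one_minus_neq_0 _ (Cmod_pow_lt_1 (p ^ 2) n Hp2)).
    assert (E : p ^ (S n + S n) = (p ^ 2) ^ S n)
      by (rewrite <- Cpow_mult_r; f_equal; lia).
    specialize (Hrec n). rewrite E, IH, (Cpow_S (p ^ 2) n) in Hrec.
    rewrite (Cpow_S (p ^ 2) n) in H1. cbn [qpoch].
    replace (csum (F (S n)) (S n))
      with ((1 - p ^ 2 * (p ^ 2) ^ n) * csum (F (S n)) (S n) / (1 - p ^ 2 * (p ^ 2) ^ n))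
      by (field; exact H1).
    rewrite Hrec. field. split; assumption.
Qed.

(** The conjugate Bailey pair of the argument: a q-Chu-Vandermonde sum in base q^2
    with parameter -q, where m = n - r counts from the first nonzero term. Again by
    Wilf-Zeilberger: both sides satisfy the same first-order recurrence in M, which
    for the left side is the telescoping sum [Htel]. *)
Lemma chu_vandermonde_sum (q : C) (r M : nat) :
  (Cmod q < 1)%R ->
  (1 + q ^ (r + S r)) *
  csum (fun m => q ^ ((r + m) * (r + m + 2)) * qpoch (- q) (q ^ 2) (r + m) *
          (qfact_inv (q ^ 2) (M - m) *
           (qfact_inv (q ^ 2) m * qfact_inv (q ^ 2) (m + (r + S r))))) M =
  qpoch (- q) (q ^ 2) (S (r + M)) * q ^ (r * (r + 2)) *
    (qfact_inv (q ^ 2) M * qfact_inv (q ^ 2) (M + (r + S r))).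
Proof.
  intros Hq. assert (Hq2 := Cmod_pow_lt_1 q 1 Hq).
  assert (Hx : forall k, (q ^ 2) ^ k = q ^ (k + k))
    by (intros k; rewrite <- Cpow_mult_r; f_equal; lia).
  assert (He : forall k, (1 - q ^ (S k + S k)) * qfact_inv (q ^ 2) (S k) = qfact_inv (q ^ 2) k)
    by (intros k; rewrite <- Hx; apply qfact_inv_S, Hq2).
  assert (Hnz : forall k, 1 - q ^ (S k + S k) <> 0)
    by (intros k; apply one_minus_neq_0, (Cmod_pow_lt_1 q (k + S k)), Hq).
  assert (Ha : forall k,
    qpoch (- q) (q ^ 2) (S k) = qpoch (- q) (q ^ 2) k * (1 + q ^ (k + S k))).
  { intros k. cbn [qpoch]. rewrite Hx, Nat.add_succ_r, (Cpow_S q (k + k)). ring. }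
  assert (He0 : qfact_inv (q ^ 2) 0 = 1) by (unfold qfact_inv; simpl; field).
  set (e := qfact_inv (q ^ 2)) in *. set (A := qpoch (- q) (q ^ 2)) in *.
  clearbody e A.
  set (H := fun M m => q ^ ((r + m) * (r + m + 2)) * A (r + m)%nat *
          (e (M - m)%nat * (e m * e (m + (r + S r))%nat))).
  change ((1 + q ^ (r + S r)) * csum (H M) M =
          A (S (r + M)) * q ^ (r * (r + 2)) * (e M * e (M + (r + S r))%nat)).
  (* partial sums of the recurrence, in closed form *)
  assert (Htel : forall M k, (k <= M)%nat ->
    csum (fun m => (1 - q ^ (S M + S M)) * (1 - q ^ (S (M + (r + S r)) + S (M + (r + S r))))
                     * H (S M) m
                   - (1 + q ^ (S (r + M) + S (S (r + M)))) * H M m) k =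
    - q ^ (S (r + M) + S (S (r + M))) * q ^ ((r + k) * (r + k + 2)) * A (S (r + k)) *
      (e (M - k)%nat * (e k * e (k + (r + S r))%nat))).
  { clear M. intros M. induction k as [|k IH]; intros Hk.
    - rewrite csum_O. unfold H. rewrite !Nat.sub_0_r, Nat.add_0_r, Ha, <- (He M).
      cbn [Nat.add].
      repeat rewrite ?Cpow_add_r, ?Cpow_S. cbn [Cpow]. ring.
    - rewrite csum_S, IH by lia. unfold H.
      assert (Hj : exists j, M = (S k + j)%nat) by (exists (M - S k)%nat; lia).
      destruct Hj as [j ->].
      replace (S k + j - k)%nat with (S j) by lia.
      replace (S (S k + j) - S k)%nat with (S j) by lia.
      replace (S k + j - S k)%nat with j by lia.
      replace (S k + (r + S r))%nat with (S (k + (r + S r))) by lia.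
      rewrite <- (He j), <- (He k), <- (He (k + (r + S r))%nat).
      rewrite (Nat.add_succ_r r k), (Ha (S (r + k))).
      replace (S (r + k) * (S (r + k) + 2))%nat
        with ((r + k) * (r + k + 2) + (r + k + S (S (S (r + k)))))%nat by ring.
      rewrite (Cpow_add_r q ((r + k) * (r + k + 2))).
      generalize (q ^ ((r + k) * (r + k + 2))); intros c.
      repeat rewrite ?Cpow_add_r, ?Cpow_S. cbn [Cpow]. ring. }
  assert (Hrec : forall M,
    (1 - q ^ (S M + S M)) * (1 - q ^ (S (M + (r + S r)) + S (M + (r + S r))))
      * csum (H (S M)) (S M) =
    (1 + q ^ (S (r + M) + S (S (r + M)))) * csum (H M) M).
  { clear M. intros M. specialize (Htel M M (le_n M)).
    set (x := (1 - q ^ (S M + S M)) * (1 - q ^ (S (M + (r + S r)) + S (M + (r + S r))))) in *.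
    set (y := 1 + q ^ (S (r + M) + S (S (r + M)))) in *.
    assert (E : csum (fun m => x * H (S M) m - y * H M m) M =
                x * csum (H (S M)) M - y * csum (H M) M).
    { transitivity (csum (fun m => x * H (S M) m + (- y) * H M m) M).
      - apply csum_ext. intros; ring.
      - rewrite csum_plus, !csum_scal. ring. }
    rewrite Htel in E. rewrite csum_S.
    replace (y * csum (H M) M)
      with (x * csum (H (S M)) M - (x * csum (H (S M)) M - y * csum (H M) M)) by ring.
    (* the closed form at k = M cancels the last term, m = M + 1 *)
    rewrite <- E. unfold H. rewrite !Nat.sub_diag.
    replace (S M + (r + S r))%nat with (S (M + (r + S r))) by lia.
    rewrite <- (He M), <- (He (M + (r + S r))%nat), (Nat.add_succ_r r M).
    replace (S (r + M) * (S (r + M) + 2))%nat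
      with ((r + M) * (r + M + 2) + (S (r + M) + S (S (r + M))))%nat by ring.
    rewrite (Cpow_add_r q ((r + M) * (r + M + 2))). unfold x. ring. }
  induction M as [|M IH].
  - rewrite csum_O. unfold H. rewrite Nat.add_0_r, Ha. cbn [Nat.sub Nat.add].
    rewrite He0. ring.
  - specialize (Hrec M).
    replace (S M + (r + S r))%nat with (S (M + (r + S r))) by lia.
    assert (N1 := Hnz M). assert (N2 := Hnz (M + (r + S r))%nat).
    set (x1 := 1 - q ^ (S M + S M)) in *.
    set (x2 := 1 - q ^ (S (M + (r + S r)) + S (M + (r + S r)))) in *.
    replace (csum (H (S M)) (S M)) with (x1 * x2 * csum (H (S M)) (S M) / (x1 * x2))
      by (field; split; assumption).
    rewrite Hrec.
    transitivity ((1 + q ^ (S (r + M) + S (S (r + M)))) *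
      ((1 + q ^ (r + S r)) * csum (H M) M) / (x1 * x2)); [field; split; assumption|].
    rewrite IH, (Nat.add_succ_r r M), (Ha (S (r + M))).
    rewrite <- (He M), <- (He (M + (r + S r))%nat). fold x1 x2.
    field. split; assumption.
Qed.

Lemma csum_triangle (f : nat -> nat -> C) (N : nat) :
  csum (fun n => csum (f n) n) N =
  csum (fun r => csum (fun m => f (r + m)%nat r) (N - r)) N.
Proof.
  induction N as [|N IH]; [rewrite !csum_O; reflexivity|].
  rewrite !csum_S, IH, Nat.sub_diag, csum_O, Nat.add_0_r, Cplus_assoc.
  f_equal. rewrite <- csum_plus. apply csum_ext. intros r Hr.
  replace (S N - r)%nat with (S (N - r)) by lia.
  rewrite csum_S. f_equal. f_equal. lia.
Qed.

(** Bailey's lemma for the pair above: write 1 / (q^4;q^4)_n as the sum of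
    [bailey_pair_sum] with p = q^2, exchange the two sums, and evaluate the inner
    one by [chu_vandermonde_sum]. The factor 1 + q^(2r+1) of its denominator cancels
    against 1 - q^(4r+2). *)
Lemma finite_mod6_identity (q : C) (N : nat) :
  (Cmod q < 1)%R ->
  csum (fun n => q ^ (n * (n + 2)) * qpoch (- q) (q ^ 2) n / qpoch (q ^ 4) (q ^ 4) n *
                 qfact_inv (q ^ 2) (N - n)) N =
  qpoch (- q) (q ^ 2) (S N) *
  csum (fun r => (- (1)) ^ r * q ^ (r * (3 * r + 2)) * (1 - q ^ (r + S r)) *
                 (qfact_inv (q ^ 2) (N - r) * qfact_inv (q ^ 2) (N + S r))) N.
Proof.
  intros Hq. assert (Hq2 := Cmod_pow_lt_1 q 1 Hq).
  set (e := qfact_inv (q ^ 2)).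
  transitivity (csum (fun n => csum (fun r =>
    (q ^ (n * (n + 2)) * qpoch (- q) (q ^ 2) n * e (N - n)%nat) *
    ((- (1)) ^ r * (q ^ 2) ^ (r * r) * (1 - (q ^ 2) ^ (r + S r)) *
       (e (n - r)%nat * e (n + S r)%nat))) n) N).
  { apply csum_ext. intros n Hn. rewrite csum_scal.
    unfold e at 2 3. rewrite bailey_pair_sum by exact Hq2.
    rewrite <- Cpow_mult_r. change (2 * 2)%nat with 4%nat. fold e. unfold Cdiv. ring. }
  rewrite csum_triangle, <- csum_scal. apply csum_ext. intros r Hr.
  assert (Hnz : 1 + q ^ (r + S r) <> 0).
  { replace (1 + q ^ (r + S r)) with (1 - - q ^ (r + S r)) by ring.
    apply one_minus_neq_0. rewrite Cmod_opp, Nat.add_succ_r.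
    apply Cmod_pow_lt_1, Hq. }
  assert (V := chu_vandermonde_sum q r (N - r) Hq). fold e in V.
  replace (r + (N - r))%nat with N in V by lia.
  replace (N - r + (r + S r))%nat with (N + S r)%nat in V by lia.
  set (W := csum _ _) in V.
  transitivity ((- (1)) ^ r * (q ^ 2) ^ (r * r) * (1 - (q ^ 2) ^ (r + S r)) * W).
  { unfold W. rewrite <- csum_scal. apply csum_ext. intros m Hm.
    replace (N - (r + m))%nat with (N - r - m)%nat by lia.
    replace (r + m - r)%nat with m by lia.
    replace (r + m + S r)%nat with (m + (r + S r))%nat by lia. ring. }
  replace W with ((1 + q ^ (r + S r)) * W / (1 + q ^ (r + S r))) by (field; exact Hnz).
  rewrite V.
  replace ((q ^ 2) ^ (r + S r)) with (q ^ (r + S r) * q ^ (r + S r))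
    by (rewrite <- Cpow_mult_r, <- Cpow_add_r; f_equal; lia).
  replace (r * (3 * r + 2))%nat with (2 * (r * r) + r * (r + 2))%nat by ring.
  rewrite (Cpow_add_r q (2 * (r * r))), (Cpow_mult_r q 2 (r * r)).
  field. exact Hnz.
Qed.

(** * The limit of the finite identity *)

(** Folded around its middle, the series f(-q^5,-q) has the coefficients of the
    sum on the right of [finite_mod6_identity]. *)
Lemma theta_term_mod6 (q : C) (n : nat) :
  theta_term (- q ^ 5) (- q) (Z.of_nat n) + theta_term (- q ^ 5) (- q) (- Z.of_nat (S n)) =
  (- (1)) ^ n * q ^ (n * (3 * n + 2)) * (1 - q ^ (n + S n)).
Proof.
  assert (HQ : forall k, (- q ^ 5 * - q) ^ k = q ^ (6 * k)).
  { intros k. rewrite Cpow_mult_r. f_equal. ring. }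
  assert (Hpos : theta_term (- q ^ 5) (- q) (Z.of_nat n) =
                 (- (1)) ^ n * q ^ (n * (3 * n + 2))).
  { induction n as [|n IH]; [rewrite theta_term_0; simpl; ring|].
    rewrite theta_term_pos_S, IH, HQ, (Cpow_S _ n).
    replace (S n * (3 * S n + 2))%nat with (n * (3 * n + 2) + (6 * n + 5))%nat by ring.
    rewrite !(Cpow_add_r q). ring. }
  assert (Hneg : forall k, theta_term (- q ^ 5) (- q) (- Z.of_nat k) =
                 (- (1)) ^ k * q ^ (k * (3 * k - 2))).
  { induction k as [|k IH]; [simpl (- Z.of_nat 0)%Z; rewrite theta_term_0; simpl; ring|].
    rewrite theta_term_neg_S, IH, HQ, (Cpow_S _ k).
    replace (S k * (3 * S k - 2))%nat with (k * (3 * k - 2) + (6 * k + 1))%nat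
      by (destruct k; [reflexivity|];
          replace (3 * S k - 2)%nat with (3 * k + 1)%nat by lia;
          replace (3 * S (S k) - 2)%nat with (3 * k + 4)%nat by lia; ring).
    rewrite !(Cpow_add_r q). ring. }
  rewrite Hpos, Hneg, (Cpow_S _ n).
  replace (S n * (3 * S n - 2))%nat with (n * (3 * n + 2) + (n + S n))%nat
    by (replace (3 * S n - 2)%nat with (3 * n + 1)%nat by lia; ring).
  rewrite (Cpow_add_r q (n * _)). ring.
Qed.

Lemma mod6_sum (q : C) :
  (Cmod q < 1)%R ->
  is_series
    (fun n => q ^ (n * (n + 2)) * qpoch (- q) (q ^ 2) n / qpoch (q ^ 4) (q ^ 4) n)
    (qpoch_inf (- q) (q ^ 2) * ramanujan_f (- q ^ 5) (- q) / qpoch_inf (q ^ 2) (q ^ 2)).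
Proof.
  intros Hq.
  assert (Hq2 := Cmod_pow_lt_1 q 1 Hq). assert (Hq4 := Cmod_pow_lt_1 q 3 Hq).
  assert (Ha : (Cmod (- q ^ 5) < 1)%R) by (rewrite Cmod_opp; apply (Cmod_pow_lt_1 q 4 Hq)).
  assert (Hb : (Cmod (- q) < 1)%R) by (rewrite Cmod_opp; exact Hq).
  set (a := fun n : nat => _).
  assert (Hdom : dominated a).
  { destruct (qpoch_bounded (- q) (q ^ 2) Hq2) as [K HK].
    destruct (qpoch_inv_bounded (q ^ 4) (q ^ 4) Hq4 Hq4) as [L HL].
    apply (dominated_geometric a (K * L) (Cmod q)).
    - split; [apply Cmod_ge_0 | exact Hq].
    - intros n. unfold a, Cdiv.
      replace (n * (n + 2))%nat with (n + n * (n + 1))%nat by ring.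
      rewrite Cpow_add_r, !Cmod_mult, (Cmod_pow q n).
      assert (H1 := Cmod_pow_le_1 q (n * (n + 1)) (Rlt_le _ _ Hq)).
      specialize (HK n). specialize (HL n).
      assert (H0 := pow_le _ n (Cmod_ge_0 q)).
      assert (H2 := Cmod_ge_0 (q ^ (n * (n + 1)))).
      assert (H3 := Cmod_ge_0 (qpoch (- q) (q ^ 2) n)).
      assert (H4 := Cmod_ge_0 (/ qpoch (q ^ 4) (q ^ 4) n)).
      rewrite (Rmult_comm (K * L)), <- Rmult_assoc.
      repeat apply Rmult_le_compat; try assumption;
        try (apply Rmult_le_pos; try assumption; apply Rmult_le_pos; assumption).
      rewrite <- (Rmult_1_r (Cmod q ^ n)) at 2.
      apply Rmult_le_compat_l; assumption. }
  destruct (dominated_ex_series a Hdom) as [s Hs].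
  destruct (qpoch_inv_bounded (q ^ 2) (q ^ 2) Hq2 Hq2) as [K HK].
  set (E := qpoch_inf (q ^ 2) (q ^ 2)).
  assert (HE : E <> 0) by (apply qpoch_inf_neq_0; exact Hq2).
  assert (L : tends (fun N => csum (fun n => a n * qfact_inv (q ^ 2) (N - n)) N) (s * / E)).
  { apply (tannery a (fun N n => qfact_inv (q ^ 2) (N - n)) _ s K); try assumption.
    - intros n. apply (tends_subseq _ _ (fun N => N - n)%nat n); [intros; lia|].
      apply qfact_inv_tends, Hq2.
    - intros N n. apply HK. }
  assert (R := tends_mult _ _ _ _
    (tends_subseq _ _ S 0 ltac:(intros; lia) (qpoch_tends (- q) (q ^ 2) Hq2))
    (folded_sum_tends (q ^ 2) _ _ Hq2
      (dominated_plus _ _ (theta_pos_dominated _ _ Ha Hb) (theta_neg_dominated _ _ Ha Hb))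
      (ramanujan_f_series _ _ Ha Hb))).
  assert (Heq : s * / E = qpoch_inf (- q) (q ^ 2) *
                          (ramanujan_f (- q ^ 5) (- q) * (/ E * / E))).
  { eapply tends_unique; [exact L|]. eapply tends_ext; [|exact R].
    intros N. cbv beta. unfold a. rewrite finite_mod6_identity by exact Hq.
    f_equal. apply csum_ext. intros n _. rewrite theta_term_mod6. reflexivity. }
  replace (_ / _) with s; [exact Hs|].
  replace s with (s * / E * E) by (field; exact HE).
  rewrite Heq. field. exact HE.
Qed.

(** * The theta quotient *)

Lemma psi_opp_product (q : C) :
  (Cmod q < 1)%R ->
  ramanujan_psi (- q) = qpoch_inf q (q ^ 2) * qpoch_inf (q ^ 4) (q ^ 4).
Proof.
  intros Hq. assert (Hq2 := Cmod_pow_lt_1 q 1 Hq).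
  unfold ramanujan_psi. rewrite jacobi_triple_product.
  - replace (- - q) with q by ring.
    replace (- (- q) ^ 3) with (q * q ^ 2) by ring.
    replace (- q * (- q) ^ 3) with (q ^ 4) by ring.
    f_equal. rewrite <- (qpoch_inf_split2 q (q ^ 2)) by exact Hq2.
    rewrite <- Cpow_mult_r. reflexivity.
  - rewrite Cmod_opp. exact Hq.
  - apply (Cmod_pow_lt_1 (- q) 2). rewrite Cmod_opp. exact Hq.
Qed.

Lemma f_mod6_product (q : C) :
  (Cmod q < 1)%R ->
  ramanujan_f (- q) (- q ^ 5) =
  qpoch_inf q (q ^ 6) * qpoch_inf (q ^ 5) (q ^ 6) * qpoch_inf (q ^ 6) (q ^ 6).
Proof.
  intros Hq. rewrite jacobi_triple_product.
  - replace (- - q) with q by ring. replace (- - q ^ 5) with (q ^ 5) by ring.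
    replace (- q * - q ^ 5) with (q ^ 6) by ring. reflexivity.
  - rewrite Cmod_opp; exact Hq.
  - rewrite Cmod_opp; apply (Cmod_pow_lt_1 q 4 Hq).
Qed.

Theorem mainTheorem7 (q : C) (hq : (Cmod q < 1)%R) :
  (is_series
     (fun n : nat =>
        q ^ (n * (n + 2)) * qpoch (- q) (q ^ 2) n / qpoch (q ^ 4) (q ^ 4) n)
     (ramanujan_f (- q) (- q ^ 5) / ramanujan_psi (- q)) /\
   ramanujan_f (- q) (- q ^ 5) / ramanujan_psi (- q) =
   qpoch_inf (q ^ 6) (q ^ 6) /
   (qpoch_inf (q ^ 4) (q ^ 4) *
    (qpoch_inf (q ^ 3) (q ^ 12) * qpoch_inf (q ^ 9) (q ^ 12))))%C.
Proof.
  assert (h : forall n, (Cmod (q ^ S n) < 1)%R) by (intros n; apply Cmod_pow_lt_1, hq).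
  assert (h2 := h 1%nat). assert (h3 := h 2%nat). assert (h4 := h 3%nat).
  assert (h6 := h 5%nat).
  assert (Hpsi := psi_opp_product q hq).
  assert (Hf := f_mod6_product q hq).
  assert (Hsym : ramanujan_f (- q ^ 5) (- q) = ramanujan_f (- q) (- q ^ 5))
    by (apply ramanujan_f_comm; rewrite Cmod_opp; [apply (h 4%nat) | exact hq]).
  assert (N0 := qpoch_inf_neq_0 q (q ^ 2) hq h2).
  assert (N2 := qpoch_inf_neq_0 (q ^ 2) (q ^ 2) h2 h2).
  assert (N4 := qpoch_inf_neq_0 (q ^ 4) (q ^ 4) h4 h4).
  assert (N3 := qpoch_inf_neq_0 (q ^ 3) (q ^ 6) h3 h6).
  split.
  - replace (ramanujan_f (- q) (- q ^ 5) / ramanujan_psi (- q))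
      with (qpoch_inf (- q) (q ^ 2) * ramanujan_f (- q ^ 5) (- q) /
            qpoch_inf (q ^ 2) (q ^ 2)); [apply mod6_sum, hq|].
    (* (q^2;q^2) = (q^2;q^4) (q^4;q^4) and (q^2;q^4) = (q;q^2) (-q;q^2) *)
    assert (E1 := qpoch_inf_split2 (q ^ 2) (q ^ 2) h2).
    rewrite <- Cpow_mult_r in E1. cbn [Nat.mul Nat.add] in E1.
    replace (q ^ 2 * q ^ 2) with (q ^ 4) in E1 by ring.
    assert (E2 := qpoch_inf_mul_opp q (q ^ 2) h2).
    rewrite <- Cpow_mult_r in E2. cbn [Nat.mul Nat.add] in E2.
    rewrite <- E2 in E1.
    rewrite Hsym, Hpsi, <- E1 in *.
    assert (N1 : qpoch_inf (- q) (q ^ 2) <> 0)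
      by (apply qpoch_inf_neq_0; [rewrite Cmod_opp; exact hq | exact h2]).
    field. repeat split; assumption.
  - rewrite Hpsi, Hf.
    (* (q;q^2) = (q,q^3,q^5;q^6) and (q^3;q^6) = (q^3,q^9;q^12) *)
    assert (E1 := qpoch_inf_split3 q (q ^ 2) h2).
    rewrite <- !Cpow_mult_r in E1. cbn [Nat.mul Nat.add] in E1.
    replace (q * q ^ 2) with (q ^ 3) in E1 by ring.
    replace (q * q ^ 4) with (q ^ 5) in E1 by ring.
    assert (E2 := qpoch_inf_split2 (q ^ 3) (q ^ 6) h6).
    rewrite <- Cpow_mult_r in E2. cbn [Nat.mul Nat.add] in E2.
    replace (q ^ 3 * q ^ 6) with (q ^ 9) in E2 by ring.
    rewrite E2. rewrite <- E1 in N0 |- *.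
    field. repeat split; try assumption; intros Z; apply N0; rewrite Z; ring.
Qed.
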